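(* Let $p\ge 2$ and $n\ge 1$ be integers, let $\Sigma$ be a real $p\times p$ symmetric positive definite matrix, and let $x_1,\dots,x_n$ be i.i.d. $N(0,\Sigma)$ random vectors in $\mathbb{R}^p$. Let $\widehat S=\frac1n\sum_{i=1}^n x_ix_i^T$ and $\widehat F=\frac{\mathrm{Tr}(\widehat S)}{p}I_p$. Then the function $$\rho\mapsto E\left\{\left\|(1-\rho)\widehat S+\rho \widehat F-\Sigma\right\|_F^2\right\},\qquad \rho\in\mathbb{R},$$ has a unique minimizer $\rho_O$, and $$\rho_O=\frac{E\{\mathrm{Tr}((\Sigma-\widehat S)(\widehat F-\widehat S))\}}{E\{\|\widehat S-\widehat F\|_F^2\}}=\frac{(1-2/p)\,\mathrm{Tr}(\Sigma^2)+\mathrm{Tr}^2(\Sigma)}{(n+1-2/p)\,\mathrm{Tr}(\Sigma^2)+(1-n/p)\,\mathrm{Tr}^2(\Sigma)}.$$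
   Context: $\|\cdot\|_F$ is the Frobenius norm, $\mathrm{Tr}$ the trace, and $\mathrm{Tr}^2(A)$ means $(\mathrm{Tr}(A))^2$. $\widehat S$ is called the sample covariance and $\widehat F$ the shrinkage target; the estimator $(1-\rho_O)\widehat S+\rho_O\widehat F$ is called the oracle estimator. *)

(* Defs.v *)
(* No measure theory is installed, so the
   Gaussian expectation is built from (improper) Riemann integrals:
   x_i = A z_i with z a vector of i.i.d. standard normal coordinates and
   A A^T = Sigma, and E is the iterated improper Riemann integral against the
   standard normal density over the n*p coordinates of z. *)
From Stdlib Require Import Reals Lra ClassicalEpsilon.
Open Scope R_scope.

Fixpoint sumn (m : nat) (f : nat -> R) : R :=
  match m with
  | O => 0
  | S m' => sumn m' f + f m'
  end.

(* p x p real matrices: entries (j,k) with j,k < p *)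
Definition mat := nat -> nat -> R.

Definition trace (p : nat) (M : mat) : R := sumn p (fun j => M j j).

Definition trace_mul (p : nat) (M N : mat) : R :=
  sumn p (fun j => sumn p (fun k => M j k * N k j)).

Definition frob2 (p : nat) (M : mat) : R :=
  sumn p (fun j => sumn p (fun k => (M j k) ^ 2)).

Definition idmat (c : R) : mat := fun j k => if Nat.eqb j k then c else 0.

Definition std_density (t : R) : R := exp (- (t ^ 2) / 2) / sqrt (2 * PI).

Definition improper_integral (h : R -> R) (l : R) : Prop :=
  forall eps, eps > 0 -> exists M, forall a b, M <= a -> M <= b ->
    exists pr : Riemann_integrable h (- a) b, Rabs (RiemannInt pr - l) < eps.

Definition gauss1 (g : R -> R) : R :=
  epsilon (inhabits 0) (fun l => improper_integral (fun t => g t * std_density t) l).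

Definition upd (z : nat -> R) (k : nat) (t : R) : nat -> R :=
  fun j => if Nat.eqb j k then t else z j.

Fixpoint gexp (N : nat) (f : (nat -> R) -> R) : R :=
  match N with
  | O => f (fun _ => 0)
  | S N' => gexp N' (fun z => gauss1 (fun t => f (upd z N' t)))
  end.

(* x_i = A z_i, z_i = (z (i*p), ..., z (i*p + p - 1)); x_i ~ N(0, A A^T) *)
Definition sample (p : nat) (A : mat) (z : nat -> R) (i j : nat) : R :=
  sumn p (fun k => A j k * z (i * p + k)%nat).

Definition Shat (p n : nat) (A : mat) (z : nat -> R) : mat :=
  fun j k => / INR n * sumn n (fun i => sample p A z i j * sample p A z i k).

Definition Fhat (p n : nat) (A : mat) (z : nat -> R) : mat :=
  idmat (trace p (Shat p n A z) / INR p).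

(* Main.v *)
Require Import Defs.
From Stdlib Require Import Reals Lra Lia Psatz ClassicalEpsilon FunctionalExtensionality.
Open Scope R_scope.

(* Pointwise, ||(1 - rho) S + rho F - Sigma||^2
     = ||S - Sigma||^2 - 2 rho Tr((Sigma - S)(F - S)) + rho^2 ||S - F||^2
   (S and F are symmetric), so by linearity of the expectation the risk is a
   quadratic e0 - 2 rho e1 + rho^2 e2 whose coefficients are expectations; as
   e2 > 0, its unique minimiser is e1 / e2.  The closed form comes from the
   first two moments of the entries of S, which follow from Isserlis' (Wick's)
   formula for four affine forms in the i.i.d. standard coordinates z.

   Every expectation carries the factor
   m0^(n p), which cancels in the ratio. *)

(* The Riemann integral of [f] over [a, b] as a total function (meaningful
   when [f] is integrable there). *)
Definition RInt (f : R -> R) (a b : R) : R :=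
  epsilon (inhabits 0) (fun v => exists pr : Riemann_integrable f a b, RiemannInt pr = v).

Lemma RInt_eq f a b (pr : Riemann_integrable f a b) : RInt f a b = RiemannInt pr.
Proof.
  unfold RInt.
  destruct (epsilon_spec (inhabits 0)
              (fun v => exists pr : Riemann_integrable f a b, RiemannInt pr = v))
    as [pr' <-]; [now exists (RiemannInt pr), pr |].
  apply RiemannInt_P5.
Qed.

Lemma cont_integrable f a b : continuity f -> a <= b -> Riemann_integrable f a b.
Proof. intros Hf Hab. now apply continuity_implies_RiemannInt. Qed.

Lemma RInt_lin f g l a b : continuity f -> continuity g -> a <= b ->
  RInt (fun x => f x + l * g x) a b = RInt f a b + l * RInt g a b.
Proof.
  intros Hf Hg Hab.
  pose proof (cont_integrable f a b Hf Hab) as p1.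
  pose proof (cont_integrable g a b Hg Hab) as p2.
  rewrite (RInt_eq _ _ _ (RiemannInt_P10 l p1 p2)), (RInt_eq _ _ _ p1), (RInt_eq _ _ _ p2).
  apply RiemannInt_P13.
Qed.

Lemma cont_of_derivative f f' : (forall x, derivable_pt_lim f x (f' x)) -> continuity f.
Proof. intros H x. apply derivable_continuous_pt. exists (f' x). apply H. Qed.

Lemma RInt_FTC (F f : R -> R) a b : (forall x, derivable_pt_lim F x (f x)) ->
  continuity f -> a <= b -> RInt f a b = F b - F a.
Proof.
  intros HF Hf Hab.
  set (d := (fun x => exist _ (f x) (HF x)) : derivable F).
  set (C := {| c1 := F; diff0 := d; cont1 := Hf : continuity (derive F d) |}).
  pose proof (cont_integrable f a b Hf Hab) as p.
  rewrite (RInt_eq _ _ _ p).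
  exact (@FTC_Riemann C a b p).
Qed.

Lemma RInt_le f g a b : continuity f -> continuity g -> a <= b ->
  (forall x, a < x < b -> f x <= g x) -> RInt f a b <= RInt g a b.
Proof.
  intros Hf Hg Hab H.
  pose proof (cont_integrable f a b Hf Hab) as p1.
  pose proof (cont_integrable g a b Hg Hab) as p2.
  rewrite (RInt_eq _ _ _ p1), (RInt_eq _ _ _ p2).
  now apply RiemannInt_P19.
Qed.

Lemma RInt_chasles f a b c : continuity f -> a <= b -> b <= c ->
  RInt f a b + RInt f b c = RInt f a c.
Proof.
  intros Hf H1 H2.
  pose proof (cont_integrable f a b Hf H1) as p1.
  pose proof (cont_integrable f b c Hf H2) as p2.
  pose proof (cont_integrable f a c Hf (Rle_trans _ _ _ H1 H2)) as p3.
  rewrite (RInt_eq _ _ _ p1), (RInt_eq _ _ _ p2), (RInt_eq _ _ _ p3).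
  apply RiemannInt_P26.
Qed.

Lemma cont_const c : continuity (fun _ => c).
Proof. apply continuity_const. now intros ? ?. Qed.

Lemma RInt_const c a b : a <= b -> RInt (fun _ => c) a b = c * (b - a).
Proof.
  intros Hab. rewrite (RInt_FTC (fun x => c * x) (fun _ => c)); auto using cont_const.
  - ring.
  - intro x. pose proof (derivable_pt_lim_scal id c x 1 (derivable_pt_lim_id x)) as H.
    now rewrite Rmult_1_r in H.
Qed.

Lemma RInt_scal f k a b : continuity f -> a <= b ->
  RInt (fun x => k * f x) a b = k * RInt f a b.
Proof.
  intros Hf Hab.
  pose proof (RInt_lin (fun _ => 0) f k a b (cont_const 0) Hf Hab) as H.
  rewrite RInt_const in H by exact Hab.
  replace (fun x => 0 + k * f x) with (fun x => k * f x) in H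
    by (apply functional_extensionality; intro; ring).
  rewrite H; ring.
Qed.

Lemma RInt_ge0 f a b : continuity f -> a <= b -> (forall x, 0 <= f x) -> 0 <= RInt f a b.
Proof.
  intros Hf Hab H. rewrite <- (Rmult_0_l (b - a)), <- RInt_const by exact Hab.
  apply RInt_le; auto using cont_const.
Qed.

Lemma improper_integral_RInt f l : continuity f ->
  (forall eps, 0 < eps -> exists M, 0 <= M /\
     forall a b, M <= a -> M <= b -> Rabs (RInt f (-a) b - l) < eps) ->
  improper_integral f l.
Proof.
  intros Hf H eps He. destruct (H eps He) as [M [HM0 HM]].
  exists M. intros a b Ha Hb.
  exists (cont_integrable f (-a) b Hf ltac:(lra)).
  rewrite <- RInt_eq. auto.
Qed.

Lemma RInt_of_improper_integral f l : improper_integral f l ->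
  forall eps, 0 < eps -> exists M, 0 <= M /\
     forall a b, M <= a -> M <= b -> Rabs (RInt f (-a) b - l) < eps.
Proof.
  intros H eps He. destruct (H eps He) as [M HM].
  exists (Rmax 0 M). split; [apply Rmax_l |]. intros a b Ha Hb.
  pose proof (Rmax_r 0 M).
  destruct (HM a b ltac:(lra) ltac:(lra)) as [pr Hpr].
  now rewrite (RInt_eq _ _ _ pr).
Qed.

Lemma improper_integral_unique f l1 l2 :
  improper_integral f l1 -> improper_integral f l2 -> l1 = l2.
Proof.
  intros H1 H2. destruct (Req_dec l1 l2) as [|Hne]; [assumption | exfalso].
  assert (Hd : 0 < Rabs (l1 - l2)) by (apply Rabs_pos_lt; lra).
  destruct (H1 (Rabs (l1 - l2) / 2)) as [M1 HM1]; [lra|].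
  destruct (H2 (Rabs (l1 - l2) / 2)) as [M2 HM2]; [lra|].
  set (a := Rmax M1 M2).
  destruct (HM1 a a (Rmax_l _ _) (Rmax_l _ _)) as [p1 Hp1].
  destruct (HM2 a a (Rmax_r _ _) (Rmax_r _ _)) as [p2 Hp2].
  rewrite (RiemannInt_P5 p1 p2) in Hp1.
  pose proof (Rabs_triang (RiemannInt p2 - l2) (- (RiemannInt p2 - l1))) as T.
  rewrite Rabs_Ropp in T. replace (RiemannInt p2 - l2 + - (RiemannInt p2 - l1)) with (l1 - l2) in T
    by ring. lra.
Qed.

Lemma improper_integral_lin f g k l1 l2 : improper_integral f l1 -> improper_integral g l2 ->
  improper_integral (fun x => f x + k * g x) (l1 + k * l2).
Proof.
  intros Hf Hg eps He.
  assert (Hk : 0 < Rabs k + 1) by (pose proof (Rabs_pos k); lra).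
  destruct (Hf (eps/2)) as [M1 HM1]; [lra|].
  destruct (Hg (eps/2/(Rabs k + 1))) as [M2 HM2]; [apply Rdiv_lt_0_compat; lra|].
  exists (Rmax M1 M2). intros a b Ha Hb.
  pose proof (Rmax_l M1 M2). pose proof (Rmax_r M1 M2).
  destruct (HM1 a b ltac:(lra) ltac:(lra)) as [p1 H1].
  destruct (HM2 a b ltac:(lra) ltac:(lra)) as [p2 H2].
  exists (RiemannInt_P10 k p1 p2). rewrite (RiemannInt_P13 p1 p2).
  replace (RiemannInt p1 + k * RiemannInt p2 - (l1 + k * l2)) with
    ((RiemannInt p1 - l1) + k * (RiemannInt p2 - l2)) by ring.
  eapply Rle_lt_trans; [apply Rabs_triang|]. rewrite Rabs_mult.
  assert (Rabs k * Rabs (RiemannInt p2 - l2) <= Rabs k * (eps / 2 / (Rabs k + 1)))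
    by (apply Rmult_le_compat_l; [apply Rabs_pos | lra]).
  assert (Rabs k * (eps / 2 / (Rabs k + 1)) < eps / 2).
  { apply (Rmult_lt_reg_r (Rabs k + 1)); auto.
    replace (Rabs k * (eps / 2 / (Rabs k + 1)) * (Rabs k + 1)) with (Rabs k * (eps/2))
      by (field; lra).
    pose proof (Rabs_pos k). nra. }
  lra.
Qed.

Lemma improper_integral_ext f g l :
  (forall t, f t = g t) -> improper_integral f l -> improper_integral g l.
Proof. intros H. now replace g with f by (apply functional_extensionality; exact H). Qed.

Definition norm_const := / sqrt (2 * PI).

Lemma norm_const_pos : 0 < norm_const.
Proof. unfold norm_const. apply Rinv_0_lt_compat, sqrt_lt_R0. pose proof PI_RGT_0. lra. Qed.

Lemma phi_eq t : std_density t = exp (- (t ^ 2) / 2) * norm_const.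
Proof. reflexivity. Qed.

Lemma phi_pos t : 0 < std_density t.
Proof. rewrite phi_eq. apply Rmult_lt_0_compat; [apply exp_pos | apply norm_const_pos]. Qed.

Lemma phi_even t : std_density (- t) = std_density t.
Proof. rewrite !phi_eq. now replace ((- t) ^ 2) with (t ^ 2) by ring. Qed.

Lemma phi_decr s t : 0 <= s <= t -> std_density t <= std_density s.
Proof.
  intros Hst. rewrite !phi_eq. apply Rmult_le_compat_r; [left; apply norm_const_pos |].
  destruct (Req_dec s t) as [-> | Hne]; [lra |].
  left. apply exp_increasing. nra.
Qed.

Lemma derive_phi x : derivable_pt_lim std_density x (- x * std_density x).
Proof.
  assert (Hg : derivable_pt_lim (fun t => - (t ^ 2) / 2) x (- x)).
  { replace (fun t => - (t ^ 2) / 2) with (fun t => t ^ 2 * (- / 2))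
      by (apply functional_extensionality; intro; field).
    replace (- x) with (INR 2 * x ^ Nat.pred 2 * (- / 2)) by (simpl; field).
    apply derivable_pt_lim_scal_right, derivable_pt_lim_pow. }
  replace (- x * std_density x) with (exp (- (x ^ 2) / 2) * (- x) * norm_const)
    by (rewrite phi_eq; ring).
  change std_density with (fun t => comp exp (fun t => - (t ^ 2) / 2) t * norm_const).
  apply derivable_pt_lim_scal_right, derivable_pt_lim_comp; auto.
  apply derivable_pt_lim_exp.
Qed.

Definition phik (k : nat) (t : R) : R := t ^ k * std_density t.

Lemma derive_phik k x : derivable_pt_lim (phik k) x
   (INR k * x ^ Nat.pred k * std_density x + x ^ k * (- x * std_density x)).
Proof.
  apply (derivable_pt_lim_mult (fun y => y ^ k) std_density).
  - apply derivable_pt_lim_pow.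
  - apply derive_phi.
Qed.

Lemma derive_phik_S j x :
  derivable_pt_lim (phik (S j)) x (INR (S j) * phik j x + (-1) * phik (S (S j)) x).
Proof.
  replace (INR (S j) * phik j x + (-1) * phik (S (S j)) x) with
    (INR (S j) * x ^ Nat.pred (S j) * std_density x + x ^ (S j) * (- x * std_density x))
    by (unfold phik; simpl; ring).
  apply derive_phik.
Qed.

Lemma cont_phi : continuity std_density.
Proof. exact (cont_of_derivative _ _ derive_phi). Qed.

Lemma cont_phik k : continuity (phik k).
Proof. exact (cont_of_derivative _ _ (derive_phik k)). Qed.

Lemma phik0 : phik 0 = std_density.
Proof. apply functional_extensionality; intro; unfold phik; simpl; ring. Qed.

(* Gaussian tail bound from exp u >= 1 + u, applied twice to u = t^2/4. *)
Lemma exp_quartic_bound t : t ^ 4 / 16 <= exp (t ^ 2 / 2).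
Proof.
  replace (t ^ 2 / 2) with (t ^ 2 / 4 + t ^ 2 / 4) by field. rewrite exp_plus.
  pose proof (exp_ineq1_le (t ^ 2 / 4)). pose proof (pow2_ge_0 t).
  replace (t ^ 4 / 16) with ((t ^ 2 / 4) * (t ^ 2 / 4)) by field.
  apply Rmult_le_compat; lra.
Qed.

Lemma phik_decay k : (k <= 3)%nat -> forall eps, 0 < eps ->
  exists M, 1 <= M /\ forall t, M <= Rabs t -> Rabs (phik k t) < eps.
Proof.
  intros Hk eps He.
  exists (Rmax 1 (16 * norm_const / eps + 1)). split; [apply Rmax_l |].
  intros t Ht. set (u := Rabs t) in *.
  pose proof (Rmax_l 1 (16 * norm_const / eps + 1)). pose proof (Rmax_r 1 (16 * norm_const / eps + 1)).
  pose proof norm_const_pos.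
  assert (Hu2 : t ^ 2 = u ^ 2) by (unfold u; now rewrite pow2_abs).
  assert (HE : u ^ 4 / 16 <= exp (t ^ 2 / 2)).
  { replace (u ^ 4) with ((u ^ 2) ^ 2) by ring. rewrite <- Hu2.
    replace ((t ^ 2) ^ 2) with (t ^ 4) by ring. apply exp_quartic_bound. }
  assert (Habs : Rabs (phik k t) * exp (t ^ 2 / 2) = u ^ k * norm_const).
  { unfold phik, u. rewrite phi_eq, !Rabs_mult, RPow_abs.
    rewrite (Rabs_right (exp _)) by (left; apply exp_pos).
    rewrite (Rabs_right norm_const) by lra.
    replace (- t ^ 2 / 2) with (- (t ^ 2 / 2)) by field. rewrite exp_Ropp.
    field. apply Rgt_not_eq, exp_pos. }
  assert (Huk : u ^ k <= u ^ 3) by (apply Rle_pow; [lra | lia]).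
  assert (H16 : 16 * norm_const < eps * u).
  { apply (Rmult_lt_reg_r (/ eps)); [now apply Rinv_0_lt_compat |].
    replace (eps * u * / eps) with u by (field; lra). unfold Rdiv in *. lra. }
  assert (Hu3 : 0 < u ^ 3) by (apply pow_lt; lra).
  apply (Rmult_lt_reg_r (exp (t ^ 2 / 2))); [apply exp_pos |]. rewrite Habs.
  apply Rle_lt_trans with (u ^ 3 * norm_const); [apply Rmult_le_compat_r; lra |].
  apply Rlt_le_trans with (eps * (u ^ 4 / 16)); [| apply Rmult_le_compat_l; lra].
  replace (eps * (u ^ 4 / 16)) with (u ^ 3 * (eps * u) / 16) by field.
  replace (u ^ 3 * norm_const) with (u ^ 3 * (16 * norm_const) / 16) by field.
  apply Rmult_lt_compat_r; [lra |]. now apply Rmult_lt_compat_l.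
Qed.

Definition cv_at_infinity (g : R -> R) (l : R) : Prop :=
  forall eps, 0 < eps -> exists M, forall x, M <= x -> Rabs (g x - l) < eps.

Lemma lim_of_cauchy (g : R -> R) :
  (forall eps, 0 < eps -> exists M, forall x y, M <= x -> x <= y -> Rabs (g y - g x) < eps) ->
  exists l, cv_at_infinity g l.
Proof.
  intros Hc.
  assert (Hsym : forall eps, 0 < eps -> exists M, forall x y, M <= x -> M <= y ->
                   Rabs (g y - g x) < eps).
  { intros eps He. destruct (Hc eps He) as [M HM]. exists M. intros x y Hx Hy.
    destruct (Rle_or_lt x y); [now apply HM |].
    rewrite Rabs_minus_sym. apply HM; lra. }
  assert (Hseq : Cauchy_crit (fun k => g (INR k))).
  { intros eps He. destruct (Hsym eps He) as [M HM]. destruct (INR_unbounded M) as [N HN].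
    exists N. intros k m Hk Hm. unfold R_dist. rewrite Rabs_minus_sym.
    apply le_INR in Hk, Hm. apply HM; lra. }
  destruct (R_complete _ Hseq) as [l Hl].
  exists l. intros eps He.
  destruct (Hsym (eps / 2)) as [M HM]; [lra |].
  exists M. intros x Hx.
  destruct (Hl (eps / 2)) as [N1 HN1]; [lra |].
  destruct (INR_unbounded M) as [N2 HN2].
  set (k := Nat.max N1 N2).
  assert (Hk : M <= INR k) by (pose proof (le_INR N2 k ltac:(lia)); lra).
  specialize (HN1 k ltac:(lia)). unfold R_dist in HN1.
  specialize (HM x (INR k) Hx Hk).
  replace (g x - l) with (- (g (INR k) - g x) + (g (INR k) - l)) by ring.
  eapply Rle_lt_trans; [apply Rabs_triang |]. rewrite Rabs_Ropp. lra.
Qed.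

Lemma lim_ge (g : R -> R) c x0 l : (forall x, x0 <= x -> c <= g x) ->
  cv_at_infinity g l -> c <= l.
Proof.
  intros Hg Hl. apply Rnot_lt_le. intros Hlt.
  destruct (Hl (c - l)) as [M HM]; [lra |].
  specialize (HM (Rmax M x0) (Rmax_l _ _)). specialize (Hg (Rmax M x0) (Rmax_r _ _)).
  rewrite Rabs_right in HM; lra.
Qed.

Lemma cont_lin_phi c : continuity (fun t => c * t * std_density t).
Proof.
  replace (fun t => c * t * std_density t) with (fun t => c * phik 1 t)
    by (apply functional_extensionality; intro; unfold phik; simpl; ring).
  apply continuity_scal, cont_phik.
Qed.

(* Tails of the Gaussian mass: on [x, y] and [-y, -x] with 1 <= x the mass is
   at most phi x, since phi <= t phi = (- phi)' there. *)
Lemma right_tail x y : 1 <= x -> x <= y -> 0 <= RInt std_density x y <= std_density x.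
Proof.
  intros H1 H2.
  split; [apply RInt_ge0; auto using cont_phi; intro; left; apply phi_pos |].
  apply Rle_trans with (RInt (fun t => 1 * t * std_density t) x y).
  - apply RInt_le; auto using cont_phi, cont_lin_phi.
    intros t Ht. pose proof (phi_pos t). nra.
  - rewrite (RInt_FTC (fun t => - std_density t)); auto using cont_lin_phi.
    + pose proof (phi_pos y). lra.
    + intro t. replace (1 * t * std_density t) with (- (- t * std_density t)) by ring.
      apply (derivable_pt_lim_opp std_density), derive_phi.
Qed.

Lemma left_tail x y : 1 <= x -> x <= y -> 0 <= RInt std_density (- y) (- x) <= std_density x.
Proof.
  intros H1 H2.
  assert (Hc : continuity (fun t => - t * std_density t))
    by (replace (fun t => - t * std_density t) with (fun t => -1 * t * std_density t)
          by (apply functional_extensionality; intro; ring); apply cont_lin_phi).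
  split; [apply RInt_ge0; auto using cont_phi; [lra | intro; left; apply phi_pos] |].
  apply Rle_trans with (RInt (fun t => - t * std_density t) (- y) (- x)).
  - apply RInt_le; auto using cont_phi; [lra |].
    intros t Ht. pose proof (phi_pos t). nra.
  - rewrite (RInt_FTC std_density); auto using derive_phi; [| lra].
    rewrite phi_even. pose proof (phi_pos (- y)). lra.
Qed.

Lemma phi_small eps : 0 < eps -> exists M, 1 <= M /\ forall x, M <= x -> std_density x < eps.
Proof.
  intros He. destruct (phik_decay 0 ltac:(lia) eps He) as [M [HM1 HM]].
  exists M. split; [exact HM1 |]. intros x Hx.
  specialize (HM x). rewrite phik0 in HM.
  rewrite (Rabs_right (std_density x)) in HM by (left; apply phi_pos).
  apply HM. rewrite Rabs_right; lra.
Qed.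

Lemma right_mass : exists l, 0 < l /\ cv_at_infinity (fun b => RInt std_density 0 b) l.
Proof.
  set (Rt := fun b => RInt std_density 0 b).
  destruct (lim_of_cauchy Rt) as [l Hl].
  { intros eps He. destruct (phi_small eps He) as [M [HM1 HM]]. exists M. intros x y Hx Hxy.
    unfold Rt. rewrite <- (RInt_chasles std_density 0 x y) by (auto using cont_phi; lra).
    replace (RInt std_density 0 x + RInt std_density x y - RInt std_density 0 x)
      with (RInt std_density x y) by ring.
    destruct (right_tail x y) as [T1 T2]; try lra.
    specialize (HM x Hx). rewrite Rabs_right; lra. }
  exists l. split; [| exact Hl].
  apply Rlt_le_trans with (Rt 1).
  - apply Rlt_le_trans with (RInt (fun _ => std_density 1) 0 1).
    + rewrite RInt_const by lra. pose proof (phi_pos 1). lra.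
    + apply RInt_le; auto using cont_const, cont_phi; [lra |].
      intros t Ht. apply phi_decr. lra.
  - apply (lim_ge Rt _ 1 l); auto. intros x Hx. unfold Rt.
    rewrite <- (RInt_chasles std_density 0 1 x) by (auto using cont_phi; lra).
    destruct (right_tail 1 x); lra.
Qed.

Lemma left_mass : exists l, 0 <= l /\ cv_at_infinity (fun a => RInt std_density (- a) 0) l.
Proof.
  set (Lt := fun a => RInt std_density (- a) 0).
  destruct (lim_of_cauchy Lt) as [l Hl].
  { intros eps He. destruct (phi_small eps He) as [M [HM1 HM]]. exists M. intros x y Hx Hxy.
    unfold Lt. rewrite <- (RInt_chasles std_density (- y) (- x) 0) by (auto using cont_phi; lra).
    replace (RInt std_density (- y) (- x) + RInt std_density (- x) 0 - RInt std_density (- x) 0)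
      with (RInt std_density (- y) (- x)) by ring.
    destruct (left_tail x y) as [T1 T2]; try lra.
    specialize (HM x Hx). rewrite Rabs_right; lra. }
  exists l. split; [| exact Hl].
  apply (lim_ge Lt _ 0 l); auto. intros x Hx. unfold Lt.
  apply RInt_ge0; auto using cont_phi; [lra |]. intro; left; apply phi_pos.
Qed.

(* The total Gaussian mass, as an improper integral, exists and is positive.
   (It equals 1, but only its positivity is needed below.) *)
Lemma gauss_mass_exists : exists m, 0 < m /\ improper_integral std_density m.
Proof.
  destruct right_mass as [lR [HlR lR_lim]]. destruct left_mass as [lL [HlL lL_lim]].
  exists (lL + lR). split; [lra |].
  apply improper_integral_RInt; [apply cont_phi |].
  intros eps He.
  destruct (lR_lim (eps / 2)) as [M1 HM1]; [lra |].
  destruct (lL_lim (eps / 2)) as [M2 HM2]; [lra |].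
  set (M := Rmax 0 (Rmax M1 M2)).
  assert (0 <= M /\ M1 <= M /\ M2 <= M) as (H0 & H1 & H2).
  { pose proof (Rmax_l 0 (Rmax M1 M2)); pose proof (Rmax_r 0 (Rmax M1 M2));
    pose proof (Rmax_l M1 M2); pose proof (Rmax_r M1 M2). unfold M. lra. }
  exists M. split; [exact H0 |]. intros a b Ha Hb.
  rewrite <- (RInt_chasles std_density (- a) 0 b) by (auto using cont_phi; lra).
  specialize (HM1 b ltac:(lra)). specialize (HM2 a ltac:(lra)).
  replace (RInt std_density (- a) 0 + RInt std_density 0 b - (lL + lR))
    with ((RInt std_density (- a) 0 - lL) + (RInt std_density 0 b - lR)) by ring.
  eapply Rle_lt_trans; [apply Rabs_triang |]. lra.
Qed.

Definition m0 : R := epsilon (inhabits 0) (fun m => 0 < m /\ improper_integral std_density m).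

Lemma m0_spec : 0 < m0 /\ improper_integral std_density m0.
Proof. unfold m0. apply epsilon_spec, gauss_mass_exists. Qed.

Lemma improper_integral_zero : improper_integral (fun _ => 0) 0.
Proof.
  apply improper_integral_RInt; [apply cont_const |]. intros eps He. exists 0.
  split; [lra |]. intros a b Ha Hb. rewrite RInt_const by lra.
  rewrite Rmult_0_l, Rminus_0_r, Rabs_R0. exact He.
Qed.

(* The first moment vanishes: t phi = (- phi)' and phi vanishes at infinity. *)
Lemma moment1 : improper_integral (phik 1) 0.
Proof.
  apply improper_integral_RInt; [apply cont_phik |]. intros eps He.
  destruct (phi_small (eps / 2)) as [M [HM1 HM]]; [lra |].
  exists M. split; [lra |]. intros a b Ha Hb.
  rewrite (RInt_FTC (fun t => - std_density t)); [| | apply cont_phik | lra].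
  - rewrite phi_even. pose proof (HM a Ha). pose proof (HM b Hb).
    pose proof (phi_pos a). pose proof (phi_pos b).
    rewrite Rminus_0_r. apply Rabs_def1; lra.
  - intro t. unfold phik. replace (t ^ 1 * std_density t) with (- (- t * std_density t)) by ring.
    apply (derivable_pt_lim_opp std_density), derive_phi.
Qed.

Lemma phik_parts j a b : a <= b ->
  RInt (phik (S (S j))) a b = INR (S j) * RInt (phik j) a b - (phik (S j) b - phik (S j) a).
Proof.
  intros Hab.
  set (D := fun x => INR (S j) * phik j x + (-1) * phik (S (S j)) x).
  assert (HD : continuity D) by (apply continuity_plus; apply continuity_scal, cont_phik).
  assert (HI : RInt D a b = phik (S j) b - phik (S j) a)
    by (apply RInt_FTC; auto using derive_phik_S).
  unfold D in HI.
  rewrite (RInt_lin (fun x => INR (S j) * phik j x)), RInt_scal in HI;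
    auto using cont_phik.
  - lra.
  - exact (continuity_scal _ _ (cont_phik j)).
Qed.

Lemma moment_rec j l : (j <= 2)%nat -> improper_integral (phik j) l ->
  improper_integral (phik (S (S j))) (INR (S j) * l).
Proof.
  intros Hj Hl. apply improper_integral_RInt; [apply cont_phik |]. intros eps He.
  assert (Hn : 0 < INR (S j)) by (apply lt_0_INR; lia).
  destruct (RInt_of_improper_integral _ _ Hl (eps / 2 / INR (S j))) as [M1 [HM10 HM1]].
  { apply Rdiv_lt_0_compat; lra. }
  destruct (phik_decay (S j) ltac:(lia) (eps / 4)) as [M2 [HM20 HM2]]; [lra |].
  pose proof (Rmax_l M1 M2). pose proof (Rmax_r M1 M2). set (M := Rmax M1 M2) in *.
  exists M. split; [lra |]. intros a b Ha Hb.
  rewrite phik_parts by lra.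
  specialize (HM1 a b ltac:(lra) ltac:(lra)).
  pose proof (HM2 b) as HB. pose proof (HM2 (- a)) as HA.
  rewrite Rabs_right in HB by lra. rewrite Rabs_Ropp, Rabs_right in HA by lra.
  specialize (HA ltac:(lra)). specialize (HB ltac:(lra)).
  assert (Rabs (INR (S j) * (RInt (phik j) (- a) b - l)) < eps / 2).
  { rewrite Rabs_mult, Rabs_right by lra.
    apply (Rmult_lt_reg_r (/ INR (S j))); [now apply Rinv_0_lt_compat |].
    replace (INR (S j) * Rabs (RInt (phik j) (- a) b - l) * / INR (S j))
      with (Rabs (RInt (phik j) (- a) b - l)) by (field; lra).
    unfold Rdiv in HM1. lra. }
  replace (INR (S j) * RInt (phik j) (- a) b - (phik (S j) b - phik (S j) (- a)) - INR (S j) * l)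
    with (INR (S j) * (RInt (phik j) (- a) b - l) + (- phik (S j) b + phik (S j) (- a)))
    by ring.
  eapply Rle_lt_trans; [apply Rabs_triang |].
  pose proof (Rabs_triang (- phik (S j) b) (phik (S j) (- a))). rewrite Rabs_Ropp in *. lra.
Qed.

Lemma gauss1_val g l : improper_integral (fun t => g t * std_density t) l -> gauss1 g = l.
Proof.
  intros H. unfold gauss1.
  apply (improper_integral_unique (fun t => g t * std_density t)); auto.
  apply epsilon_spec. now exists l.
Qed.

(* Gaussian expectation of a polynomial of degree at most 4, from the moments
   m0, 0, m0, 0, 3 m0. *)
Lemma gauss_poly c0 c1 c2 c3 c4 :
  improper_integral (fun t => (c0 + c1 * t + c2 * t ^ 2 + c3 * t ^ 3 + c4 * t ^ 4) * std_density t)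
    (m0 * (c0 + c2 + 3 * c4)) /\
  gauss1 (fun t => c0 + c1 * t + c2 * t ^ 2 + c3 * t ^ 3 + c4 * t ^ 4) = m0 * (c0 + c2 + 3 * c4).
Proof.
  destruct m0_spec as [_ I0]. rewrite <- phik0 in I0.
  pose proof (moment_rec 0 _ ltac:(lia) I0) as I2.
  pose proof (moment_rec 1 _ ltac:(lia) moment1) as I3.
  pose proof (moment_rec 2 _ ltac:(lia) I2) as I4.
  pose proof (improper_integral_lin _ _ c0 _ _ improper_integral_zero I0) as J0.
  pose proof (improper_integral_lin _ _ c1 _ _ J0 moment1) as J1.
  pose proof (improper_integral_lin _ _ c2 _ _ J1 I2) as J2.
  pose proof (improper_integral_lin _ _ c3 _ _ J2 I3) as J3.
  pose proof (improper_integral_lin _ _ c4 _ _ J3 I4) as J4.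
  replace (m0 * (c0 + c2 + 3 * c4))
    with (0 + c0 * m0 + c1 * 0 + c2 * (INR 1 * m0) + c3 * (INR 2 * 0) + c4 * (INR 3 * (INR 1 * m0)))
    by (simpl; ring).
  assert (J : improper_integral
                (fun t => (c0 + c1 * t + c2 * t ^ 2 + c3 * t ^ 3 + c4 * t ^ 4) * std_density t)
                (0 + c0 * m0 + c1 * 0 + c2 * (INR 1 * m0) + c3 * (INR 2 * 0)
                 + c4 * (INR 3 * (INR 1 * m0)))).
  { replace (fun t => (c0 + c1 * t + c2 * t ^ 2 + c3 * t ^ 3 + c4 * t ^ 4) * std_density t)
      with (fun x => 0 + c0 * phik 0 x + c1 * phik 1 x + c2 * phik 2 x + c3 * phik 3 x
                     + c4 * phik 4 x)
      by (apply functional_extensionality; intro; unfold phik; simpl; ring).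
    exact J4. }
  split; [exact J | now apply gauss1_val].
Qed.

Lemma INR_pos m : (1 <= m)%nat -> 0 < INR m.
Proof. intros H. apply lt_0_INR. lia. Qed.

Lemma sumn_ext m f g : (forall i, (i < m)%nat -> f i = g i) -> sumn m f = sumn m g.
Proof.
  induction m; intros H; simpl; auto.
  rewrite IHm by (intros; apply H; lia). rewrite H by lia. reflexivity.
Qed.

Lemma sumn_plus m f g : sumn m (fun i => f i + g i) = sumn m f + sumn m g.
Proof. induction m; simpl; [ring |]. rewrite IHm. ring. Qed.

Lemma sumn_scal m c f : sumn m (fun i => c * f i) = c * sumn m f.
Proof. induction m; simpl; [ring |]. rewrite IHm. ring. Qed.

Lemma sumn_const m c : sumn m (fun _ => c) = INR m * c.
Proof. induction m; simpl sumn; [simpl; ring |]. rewrite IHm, S_INR. ring. Qed.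

Lemma sumn_single m i f : (i < m)%nat -> (forall j, (j < m)%nat -> j <> i -> f j = 0) ->
  sumn m f = f i.
Proof.
  induction m; intros Hi H; [lia |]. simpl.
  destruct (Nat.eq_dec i m) as [-> | Hne].
  - rewrite (sumn_ext m f (fun _ => 0)) by (intros j Hj; apply H; lia).
    rewrite sumn_const. ring.
  - rewrite IHm by (lia || (intros; apply H; lia)). rewrite (H m) by lia. ring.
Qed.

Lemma sumn_delta m i f : (i < m)%nat -> sumn m (fun j => if Nat.eqb i j then f j else 0) = f i.
Proof.
  intros Hi. rewrite (sumn_single m i); [now rewrite Nat.eqb_refl | exact Hi |].
  intros j _ Hj. destruct (Nat.eqb_spec i j); [lia | reflexivity].
Qed.

Lemma sumn_mul m m' f g : sumn m f * sumn m' g = sumn m (fun i => sumn m' (fun j => f i * g j)).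
Proof. induction m; simpl; [ring |]. rewrite <- IHm, sumn_scal. ring. Qed.

Lemma sumn_add a b f : sumn (a + b) f = sumn a f + sumn b (fun k => f (a + k)%nat).
Proof.
  induction b; simpl.
  - rewrite Nat.add_0_r. ring.
  - rewrite Nat.add_succ_r. simpl. rewrite IHb. ring.
Qed.

Lemma sumn_block m p f : sumn (m * p) f = sumn m (fun i => sumn p (fun k => f (i * p + k)%nat)).
Proof. induction m; simpl; auto. rewrite Nat.add_comm, sumn_add, IHm. reflexivity. Qed.

Lemma sumn_le m f g : (forall i, (i < m)%nat -> f i <= g i) -> sumn m f <= sumn m g.
Proof.
  induction m; intros H; simpl; [lra |].
  pose proof (H m ltac:(lia)). pose proof (IHm ltac:(intros; apply H; lia)). lra.
Qed.

Lemma sumn_nonneg m f : (forall i, (i < m)%nat -> 0 <= f i) -> 0 <= sumn m f.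
Proof.
  intros H. replace 0 with (sumn m (fun _ => 0)) by (rewrite sumn_const; ring).
  now apply sumn_le.
Qed.

Lemma sumn_ge_term m f i : (forall i, (i < m)%nat -> 0 <= f i) -> (i < m)%nat -> f i <= sumn m f.
Proof.
  induction m; intros H Hi; [lia |]. simpl.
  destruct (Nat.eq_dec i m) as [-> | Hne].
  - pose proof (sumn_nonneg m f ltac:(intros; apply H; lia)). lra.
  - pose proof (IHm ltac:(intros; apply H; lia) ltac:(lia)). pose proof (H m ltac:(lia)). lra.
Qed.

(* [gexp N f] integrates out the coordinates N-1, ..., 0 one at a time; it is
   meaningful when every one-dimensional integral along the way exists. *)
Fixpoint gexp_integrable (N : nat) (f : (nat -> R) -> R) : Prop :=
  match N with
  | O => True
  | S N' => (forall z, exists l, improper_integral (fun t => f (upd z N' t) * std_density t) l) /\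
            gexp_integrable N' (fun z => gauss1 (fun t => f (upd z N' t)))
  end.

Definition has_gexp (N : nat) (f : (nat -> R) -> R) (v : R) : Prop :=
  gexp_integrable N f /\ gexp N f = v.

Lemma gauss1_lin f g k :
  (exists l, improper_integral (fun t => f t * std_density t) l) ->
  (exists l, improper_integral (fun t => g t * std_density t) l) ->
  (exists l, improper_integral (fun t => (f t + k * g t) * std_density t) l) /\
  gauss1 (fun t => f t + k * g t) = gauss1 f + k * gauss1 g.
Proof.
  intros [l1 H1] [l2 H2].
  assert (H : improper_integral (fun t => (f t + k * g t) * std_density t) (l1 + k * l2)).
  { eapply improper_integral_ext; [| exact (improper_integral_lin _ _ k _ _ H1 H2)].
    intro; cbv beta; ring. }
  split; [now exists (l1 + k * l2) |].
  now rewrite (gauss1_val _ _ H), (gauss1_val _ _ H1), (gauss1_val _ _ H2).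
Qed.

Lemma has_gexp_lin N : forall f g k a b, has_gexp N f a -> has_gexp N g b ->
  has_gexp N (fun z => f z + k * g z) (a + k * b).
Proof.
  induction N; intros f g k a b [If Ef] [Ig Eg].
  - split; [exact I |]. simpl in *. now subst.
  - destruct If as [If If'], Ig as [Ig Ig'].
    assert (Hslice : (fun z => gauss1 (fun t => f (upd z N t) + k * g (upd z N t))) =
                     (fun z => gauss1 (fun t => f (upd z N t)) + k * gauss1 (fun t => g (upd z N t)))).
    { apply functional_extensionality; intro z. now apply gauss1_lin. }
    destruct (IHN _ _ k a b (conj If' Ef) (conj Ig' Eg)) as [G1 G2].
    split; [split |].
    + intro z. now apply (gauss1_lin (fun t => f (upd z N t)) (fun t => g (upd z N t))).
    + cbv beta. now rewrite Hslice.
    + simpl. now rewrite Hslice.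
Qed.

Lemma has_gexp_const N c : has_gexp N (fun _ => c) (m0 ^ N * c).
Proof.
  revert c. induction N; intros c; [split; simpl; auto; ring |].
  destruct (gauss_poly c 0 0 0 0) as [I G].
  assert (Hslice : (fun z : nat -> R => gauss1 (fun _ => c)) = (fun _ => m0 * c)).
  { apply functional_extensionality; intro. transitivity (m0 * (c + 0 + 3 * 0)); [| ring].
    rewrite <- G. f_equal.
    apply functional_extensionality; intro; ring. }
  destruct (IHN (m0 * c)) as [G1 G2].
  split; [split |].
  - intro z. exists (m0 * (c + 0 + 3 * 0)).
    eapply improper_integral_ext; [| exact I]. intro t; simpl; ring.
  - cbv beta. now rewrite Hslice.
  - simpl. rewrite Hslice, G2. ring.
Qed.

Lemma has_gexp_ext N f g v : (forall z, f z = g z) -> has_gexp N f v -> has_gexp N g v.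
Proof. intros H. now replace g with f by (apply functional_extensionality; exact H). Qed.

Lemma has_gexp_add N f g a b : has_gexp N f a -> has_gexp N g b ->
  has_gexp N (fun z => f z + g z) (a + b).
Proof.
  intros Hf Hg. replace (a + b) with (a + 1 * b) by ring.
  apply (has_gexp_ext N (fun z => f z + 1 * g z)); [intro; ring |].
  now apply has_gexp_lin.
Qed.

Lemma has_gexp_scal N f k a : has_gexp N f a -> has_gexp N (fun z => k * f z) (k * a).
Proof.
  intros Hf. replace (k * a) with (m0 ^ N * 0 + k * a) by ring.
  apply (has_gexp_ext N (fun z => 0 + k * f z)); [intro; ring |].
  apply has_gexp_lin; [apply has_gexp_const | exact Hf].
Qed.

Lemma has_gexp_sumn N m F V : (forall i, (i < m)%nat -> has_gexp N (F i) (V i)) ->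
  has_gexp N (fun z => sumn m (fun i => F i z)) (sumn m V).
Proof.
  induction m; intros H.
  - pose proof (has_gexp_const N 0) as H0. now rewrite Rmult_0_r in H0.
  - simpl. apply has_gexp_add; [apply IHm; intros; apply H; lia | apply H; lia].
Qed.

Definition aff (N : nat) (c : R) (u : nat -> R) (z : nat -> R) : R :=
  c + sumn N (fun a => u a * z a).

Definition ip (N : nat) (u v : nat -> R) : R := sumn N (fun a => u a * v a).

Definition zero_vec : nat -> R := fun _ => 0.

(* Isserlis' (Wick's) formula for E[X1 X2 X3 X4] for jointly Gaussian X_i with
   means c_i and covariances i_jk. *)
Definition wick (c1 c2 c3 c4 i12 i13 i14 i23 i24 i34 : R) : R :=
  c1 * c2 * c3 * c4 + c3 * c4 * i12 + c2 * c4 * i13 + c2 * c3 * i14 + c1 * c4 * i23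
  + c1 * c3 * i24 + c1 * c2 * i34 + i12 * i34 + i13 * i24 + i14 * i23.

Definition prod4 N c1 u1 c2 u2 c3 u3 c4 u4 (z : nat -> R) : R :=
  aff N c1 u1 z * aff N c2 u2 z * aff N c3 u3 z * aff N c4 u4 z.

Lemma aff_upd N c u z t : aff (S N) c u (upd z N t) = aff N c u z + u N * t.
Proof.
  unfold aff. simpl. unfold upd at 2. rewrite Nat.eqb_refl.
  rewrite (sumn_ext N _ (fun a => u a * z a)); [ring |].
  intros a Ha. unfold upd. destruct (Nat.eqb_spec a N); [lia | reflexivity].
Qed.

Lemma aff_const N c z : aff N c zero_vec z = c.
Proof. unfold aff, zero_vec. rewrite (sumn_ext N _ (fun _ => 0)) by (intros; ring).
  rewrite sumn_const. ring. Qed.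

Lemma ip_zero_l N u : ip N zero_vec u = 0.
Proof. unfold ip, zero_vec. rewrite (sumn_ext N _ (fun _ => 0)) by (intros; ring).
  rewrite sumn_const. ring. Qed.

Lemma gauss1_affine4 a1 b1 a2 b2 a3 b3 a4 b4 :
  (exists l, improper_integral
     (fun t => (a1 + b1 * t) * (a2 + b2 * t) * (a3 + b3 * t) * (a4 + b4 * t) * std_density t) l) /\
  gauss1 (fun t => (a1 + b1 * t) * (a2 + b2 * t) * (a3 + b3 * t) * (a4 + b4 * t)) =
  m0 * wick a1 a2 a3 a4 (b1 * b2) (b1 * b3) (b1 * b4) (b2 * b3) (b2 * b4) (b3 * b4).
Proof.
  set (e1 := b1 * a2 * a3 * a4 + a1 * b2 * a3 * a4 + a1 * a2 * b3 * a4 + a1 * a2 * a3 * b4).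
  set (e2 := b1 * b2 * a3 * a4 + b1 * a2 * b3 * a4 + b1 * a2 * a3 * b4 + a1 * b2 * b3 * a4
             + a1 * b2 * a3 * b4 + a1 * a2 * b3 * b4).
  set (e3 := b1 * b2 * b3 * a4 + b1 * b2 * a3 * b4 + b1 * a2 * b3 * b4 + a1 * b2 * b3 * b4).
  assert (Hpoly : forall t, (a1 + b1 * t) * (a2 + b2 * t) * (a3 + b3 * t) * (a4 + b4 * t) =
     a1 * a2 * a3 * a4 + e1 * t + e2 * t ^ 2 + e3 * t ^ 3 + (b1 * b2 * b3 * b4) * t ^ 4)
    by (intro; unfold e1, e2, e3; ring).
  destruct (gauss_poly (a1 * a2 * a3 * a4) e1 e2 e3 (b1 * b2 * b3 * b4)) as [I G].
  split.
  - eexists. eapply improper_integral_ext; [| exact I]. intro t. now rewrite Hpoly.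
  - replace (fun t => (a1 + b1 * t) * (a2 + b2 * t) * (a3 + b3 * t) * (a4 + b4 * t))
      with (fun t => a1 * a2 * a3 * a4 + e1 * t + e2 * t ^ 2 + e3 * t ^ 3
                     + (b1 * b2 * b3 * b4) * t ^ 4)
      by (apply functional_extensionality; intro; now rewrite Hpoly).
    rewrite G. unfold e2, wick. ring.
Qed.

Lemma gauss1_prod4_slice N c1 u1 c2 u2 c3 u3 c4 u4 z :
  (exists l, improper_integral
     (fun t => prod4 (S N) c1 u1 c2 u2 c3 u3 c4 u4 (upd z N t) * std_density t) l) /\
  gauss1 (fun t => prod4 (S N) c1 u1 c2 u2 c3 u3 c4 u4 (upd z N t)) =
  m0 * wick (aff N c1 u1 z) (aff N c2 u2 z) (aff N c3 u3 z) (aff N c4 u4 z)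
            (u1 N * u2 N) (u1 N * u3 N) (u1 N * u4 N) (u2 N * u3 N) (u2 N * u4 N) (u3 N * u4 N).
Proof.
  assert (Hslice : (fun t => prod4 (S N) c1 u1 c2 u2 c3 u3 c4 u4 (upd z N t)) =
     (fun t => (aff N c1 u1 z + u1 N * t) * (aff N c2 u2 z + u2 N * t)
               * (aff N c3 u3 z + u3 N * t) * (aff N c4 u4 z + u4 N * t)))
    by (apply functional_extensionality; intro t; unfold prod4; now rewrite !aff_upd).
  destruct (gauss1_affine4 (aff N c1 u1 z) (u1 N) (aff N c2 u2 z) (u2 N)
                           (aff N c3 u3 z) (u3 N) (aff N c4 u4 z) (u4 N)) as [[l Hl] HE].
  split; [exists l | now rewrite Hslice].
  eapply improper_integral_ext; [| exact Hl]. intro t. now rewrite (equal_f Hslice t).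
Qed.

(* Wick's formula for a product of four affine forms in N i.i.d. standard
   Gaussian coordinates, by integrating out one coordinate at a time: the
   slice expectation is again a combination of products of affine forms. *)
Lemma wick_formula N : forall c1 u1 c2 u2 c3 u3 c4 u4,
  has_gexp N (prod4 N c1 u1 c2 u2 c3 u3 c4 u4)
    (m0 ^ N * wick c1 c2 c3 c4 (ip N u1 u2) (ip N u1 u3) (ip N u1 u4)
                               (ip N u2 u3) (ip N u2 u4) (ip N u3 u4)).
Proof.
  induction N; intros c1 u1 c2 u2 c3 u3 c4 u4.
  { split; [exact I |]. unfold prod4, aff, ip, wick. simpl. ring. }
  set (b1 := u1 N). set (b2 := u2 N). set (b3 := u3 N). set (b4 := u4 N).
  set (pair_term := fun (d : R) ca ua cb ub => prod4 N d zero_vec 1 zero_vec ca ua cb ub).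
  assert (Hpair : forall d ca ua cb ub,
            has_gexp N (pair_term d ca ua cb ub) (m0 ^ N * (d * (ca * cb + ip N ua ub)))).
  { intros d ca ua cb ub. unfold pair_term.
    replace (m0 ^ N * (d * (ca * cb + ip N ua ub))) with
      (m0 ^ N * wick d 1 ca cb (ip N zero_vec zero_vec) (ip N zero_vec ua) (ip N zero_vec ub)
                      (ip N zero_vec ua) (ip N zero_vec ub) (ip N ua ub))
      by (rewrite !ip_zero_l; unfold wick; ring).
    apply IHN. }
  set (slice := fun z => prod4 N c1 u1 c2 u2 c3 u3 c4 u4 z
       + pair_term (b1 * b2) c3 u3 c4 u4 z + pair_term (b1 * b3) c2 u2 c4 u4 z
       + pair_term (b1 * b4) c2 u2 c3 u3 z + pair_term (b2 * b3) c1 u1 c4 u4 z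
       + pair_term (b2 * b4) c1 u1 c3 u3 z + pair_term (b3 * b4) c1 u1 c2 u2 z
       + (b1 * b2 * (b3 * b4) + b1 * b3 * (b2 * b4) + b1 * b4 * (b2 * b3))).
  assert (Hint : (fun z => gauss1 (fun t => prod4 (S N) c1 u1 c2 u2 c3 u3 c4 u4 (upd z N t))) =
                 (fun z => m0 * slice z)).
  { apply functional_extensionality; intro z. rewrite (proj2 (gauss1_prod4_slice _ _ _ _ _ _ _ _ _ _)).
    unfold slice, pair_term, b1, b2, b3, b4. cbv beta. unfold prod4, wick. rewrite !aff_const.
    ring. }
  assert (Hsum : has_gexp N slice
     (m0 ^ N * wick c1 c2 c3 c4 (ip N u1 u2) (ip N u1 u3) (ip N u1 u4)
                              (ip N u2 u3) (ip N u2 u4) (ip N u3 u4)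
      + m0 ^ N * (b1 * b2 * (c3 * c4 + ip N u3 u4)) + m0 ^ N * (b1 * b3 * (c2 * c4 + ip N u2 u4))
      + m0 ^ N * (b1 * b4 * (c2 * c3 + ip N u2 u3)) + m0 ^ N * (b2 * b3 * (c1 * c4 + ip N u1 u4))
      + m0 ^ N * (b2 * b4 * (c1 * c3 + ip N u1 u3)) + m0 ^ N * (b3 * b4 * (c1 * c2 + ip N u1 u2))
      + m0 ^ N * (b1 * b2 * (b3 * b4) + b1 * b3 * (b2 * b4) + b1 * b4 * (b2 * b3))))
    by (repeat apply has_gexp_add; auto using has_gexp_const).
  split; [split |].
  - intro z. apply gauss1_prod4_slice.
  - cbv beta. rewrite Hint. exact (proj1 (has_gexp_scal _ _ m0 _ Hsum)).
  - simpl gexp. rewrite Hint, (proj2 (has_gexp_scal _ _ m0 _ Hsum)).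
    unfold ip. simpl sumn.
    fold (ip N u1 u2) (ip N u1 u3) (ip N u1 u4) (ip N u2 u3) (ip N u2 u4) (ip N u3 u4).
    unfold wick, b1, b2, b3, b4. simpl. ring.
Qed.

Definition dsum (p : nat) (F : nat -> nat -> R) : R := sumn p (fun j => sumn p (fun k => F j k)).

Lemma dsum_ext p F G : (forall j k, (j < p)%nat -> (k < p)%nat -> F j k = G j k) ->
  dsum p F = dsum p G.
Proof. intros H. apply sumn_ext; intros j Hj. apply sumn_ext; intros k Hk. auto. Qed.

Lemma dsum_plus p F G : dsum p (fun j k => F j k + G j k) = dsum p F + dsum p G.
Proof. unfold dsum. rewrite <- sumn_plus. apply sumn_ext; intros. apply sumn_plus. Qed.

Lemma dsum_scal p c F : dsum p (fun j k => c * F j k) = c * dsum p F.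
Proof. unfold dsum. rewrite <- sumn_scal. apply sumn_ext; intros. apply sumn_scal. Qed.

Lemma dsum_idmat p c G : dsum p (fun j k => G j k * idmat c j k) = c * trace p G.
Proof.
  unfold dsum, trace. rewrite <- sumn_scal. apply sumn_ext. intros j Hj.
  rewrite (sumn_ext p _ (fun k => if Nat.eqb j k then G j k * c else 0)).
  - rewrite sumn_delta by exact Hj. ring.
  - intros k Hk. unfold idmat. destruct (Nat.eqb j k); ring.
Qed.

Lemma idmat_sym c j k : idmat c j k = idmat c k j.
Proof. unfold idmat. now rewrite Nat.eqb_sym. Qed.

Lemma trace_idmat p c : trace p (idmat c) = INR p * c.
Proof. unfold trace, idmat. rewrite (sumn_ext p _ (fun _ => c)) by (intros; now rewrite Nat.eqb_refl).
  apply sumn_const. Qed.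

Lemma trace_sq p M : trace p M ^ 2 = dsum p (fun j k => M j j * M k k).
Proof. unfold trace, dsum. rewrite <- sumn_mul. ring. Qed.

Definition symmetric (p : nat) (M : mat) : Prop :=
  forall j k, (j < p)%nat -> (k < p)%nat -> M k j = M j k.

(* The loss of a linear shrinkage estimator is quadratic in the intensity r:
   with X = S - Sigma and Y = F - S (symmetric), ||X + r Y||^2 expands, and
   <X, Y> = - Tr((Sigma - S)(F - S)). *)
Lemma shrinkage_loss p (S F Sg : mat) r : symmetric p S -> symmetric p F ->
  frob2 p (fun j k => (1 - r) * S j k + r * F j k - Sg j k) =
  frob2 p (fun j k => S j k - Sg j k)
  - 2 * r * trace_mul p (fun j k => Sg j k - S j k) (fun j k => F j k - S j k)
  + r ^ 2 * frob2 p (fun j k => S j k - F j k).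
Proof.
  intros HS HF. unfold frob2, trace_mul. fold (dsum p (fun j k => (S j k - Sg j k) ^ 2)).
  fold (dsum p (fun j k => (S j k - F j k) ^ 2)).
  fold (dsum p (fun j k => ((1 - r) * S j k + r * F j k - Sg j k) ^ 2)).
  fold (dsum p (fun j k => (Sg j k - S j k) * (F k j - S k j))).
  rewrite (dsum_ext p (fun j k => ((1 - r) * S j k + r * F j k - Sg j k) ^ 2)
             (fun j k => (S j k - Sg j k) ^ 2 + (- 2 * r) * ((Sg j k - S j k) * (F k j - S k j))
                         + r ^ 2 * (S j k - F j k) ^ 2)).
  - rewrite !dsum_plus, !dsum_scal. ring.
  - intros j k Hj Hk. rewrite (HS j k), (HF j k) by assumption. ring.
Qed.

Lemma frob2_minus_target p (S : mat) : (0 < p)%nat ->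
  frob2 p (fun j k => S j k - idmat (trace p S / INR p) j k) = frob2 p S - trace p S ^ 2 / INR p.
Proof.
  intros Hp. assert (0 < INR p) by (apply lt_0_INR; lia).
  set (c := trace p S / INR p). unfold frob2.
  fold (dsum p (fun j k => (S j k - idmat c j k) ^ 2)). fold (dsum p (fun j k => S j k ^ 2)).
  rewrite (dsum_ext p _ (fun j k => S j k ^ 2 + (-2) * (S j k * idmat c j k)
                                    + idmat c j k * idmat c j k)) by (intros; ring).
  rewrite !dsum_plus, dsum_scal, !dsum_idmat, trace_idmat. unfold c. field. lra.
Qed.

Lemma trace_mul_shrink p (Sg S : mat) : (0 < p)%nat -> symmetric p S ->
  trace_mul p (fun j k => Sg j k - S j k) (fun j k => idmat (trace p S / INR p) j k - S j k) =
  trace p Sg * trace p S / INR p - trace_mul p Sg S - trace p S ^ 2 / INR p + frob2 p S.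
Proof.
  intros Hp HS. assert (0 < INR p) by (apply lt_0_INR; lia).
  set (c := trace p S / INR p). unfold trace_mul, frob2.
  fold (dsum p (fun j k => (Sg j k - S j k) * (idmat c k j - S k j))).
  fold (dsum p (fun j k => Sg j k * S k j)). fold (dsum p (fun j k => S j k ^ 2)).
  rewrite (dsum_ext p _ (fun j k => Sg j k * idmat c j k + (-1) * (Sg j k * S k j)
                                    + (-1) * (S j k * idmat c j k) + S j k ^ 2)).
  - rewrite !dsum_plus, !dsum_scal, !dsum_idmat. unfold c. field. lra.
  - intros j k Hj Hk. rewrite (idmat_sym c k j), (HS k j) by assumption. ring.
Qed.

Lemma frob2_minus p (S Sg : mat) : symmetric p S ->
  frob2 p (fun j k => S j k - Sg j k) = frob2 p S - 2 * trace_mul p Sg S + frob2 p Sg.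
Proof.
  intros HS. unfold trace_mul, frob2.
  fold (dsum p (fun j k => (S j k - Sg j k) ^ 2)). fold (dsum p (fun j k => Sg j k * S k j)).
  fold (dsum p (fun j k => S j k ^ 2)). fold (dsum p (fun j k => Sg j k ^ 2)).
  rewrite (dsum_ext p _ (fun j k => S j k ^ 2 + (-2) * (Sg j k * S k j) + Sg j k ^ 2)).
  - rewrite !dsum_plus, dsum_scal. ring.
  - intros j k Hj Hk. rewrite (HS j k) by assumption. ring.
Qed.

Lemma Shat_sym p n A z : symmetric p (Shat p n A z).
Proof. intros j k _ _. unfold Shat. f_equal. apply sumn_ext. intros. ring. Qed.

Lemma idmat_symmetric p c : symmetric p (idmat c).
Proof. intros j k _ _. apply idmat_sym. Qed.

Lemma has_gexp_dsum p N F V : (forall j k, (j < p)%nat -> (k < p)%nat -> has_gexp N (F j k) (V j k)) ->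
  has_gexp N (fun z => dsum p (fun j k => F j k z)) (dsum p V).
Proof. intros H. apply has_gexp_sumn; intros j Hj. apply has_gexp_sumn; intros k Hk. auto. Qed.

Lemma trace_sq_le p (M : mat) : trace p M ^ 2 <= INR p * frob2 p M.
Proof.
  assert (Hcs : 0 <= dsum p (fun j k => (M j j - M k k) ^ 2))
    by (apply sumn_nonneg; intros; apply sumn_nonneg; intros; apply pow2_ge_0).
  rewrite (dsum_ext p _ (fun j k => M j j ^ 2 + (-2) * (M j j * M k k) + M k k ^ 2)) in Hcs
    by (intros; ring).
  rewrite !dsum_plus, dsum_scal, <- (trace_sq p M) in Hcs.
  unfold dsum in Hcs.
  rewrite (sumn_ext p (fun j => sumn p (fun k => M j j ^ 2)) (fun j => INR p * M j j ^ 2)),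
          sumn_scal, sumn_const in Hcs by (intros; apply sumn_const).
  assert (Hdiag : sumn p (fun j => M j j ^ 2) <= frob2 p M).
  { apply sumn_le. intros j Hj.
    apply (sumn_ge_term p (fun k => M j k ^ 2) j); auto. intros; apply pow2_ge_0. }
  pose proof (pos_INR p). nra.
Qed.

(* The coordinate of x_i along e_j as a linear form in z: the coordinates of
   block i of z are weighted by row j of A. *)
Definition coef (p : nat) (A : mat) (i j : nat) : nat -> R :=
  fun a => if Nat.eqb (a / p) i then A j (a mod p) else 0.

Lemma coef_block p A i j i' k : (k < p)%nat ->
  coef p A i j (i' * p + k) = if Nat.eqb i' i then A j k else 0.
Proof.
  intros Hk. unfold coef.
  replace ((i' * p + k) / p)%nat with i'
    by (rewrite Nat.add_comm, Nat.div_add, Nat.div_small by lia; lia).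
  replace ((i' * p + k) mod p)%nat with k
    by (rewrite Nat.add_comm, Nat.Div0.mod_add, Nat.mod_small by lia; reflexivity).
  reflexivity.
Qed.

(* Closed forms of E Tr((Sigma - S)(F - S)) and E ||S - F||^2 (up to the mass
   factor), in terms of t1 = Tr(Sigma) and t2 = Tr(Sigma^2). *)
Definition oracle_num (p n : nat) (t1 t2 : R) : R :=
  ((1 - 2 / INR p) * t2 + t1 ^ 2) / INR n.

Definition oracle_den (p n : nat) (t1 t2 : R) : R :=
  ((INR n + 1 - 2 / INR p) * t2 + (1 - INR n / INR p) * t1 ^ 2) / INR n.

Section Moments.

Variables (p n : nat) (Sigma A : mat).
Hypothesis hp : (0 < p)%nat.
Hypothesis hn : (1 <= n)%nat.
Hypothesis hA : forall j k, (j < p)%nat -> (k < p)%nat ->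
  Sigma j k = sumn p (fun l => A j l * A k l).

Lemma sample_aff z i j : (i < n)%nat -> sample p A z i j = aff (n * p) 0 (coef p A i j) z.
Proof.
  intros Hi. unfold aff. rewrite sumn_block, Rplus_0_l.
  rewrite (sumn_single n i); [| exact Hi |].
  - apply sumn_ext. intros k Hk. now rewrite coef_block, Nat.eqb_refl.
  - intros i' _ Hne. rewrite (sumn_ext p _ (fun _ => 0)); [rewrite sumn_const; ring |].
    intros k Hk. rewrite coef_block by exact Hk.
    destruct (Nat.eqb_spec i' i); [lia | ring].
Qed.

Lemma ip_coef i i' j j' : (i < n)%nat -> (j < p)%nat -> (j' < p)%nat ->
  ip (n * p) (coef p A i j) (coef p A i' j') = if Nat.eqb i i' then Sigma j j' else 0.
Proof.
  intros Hi Hj Hj'. unfold ip. rewrite sumn_block.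
  rewrite (sumn_single n i); [| exact Hi |].
  - rewrite (sumn_ext p _ (fun k => if Nat.eqb i i' then A j k * A j' k else 0)).
    + destruct (Nat.eqb i i'); [now rewrite hA | rewrite sumn_const; ring].
    + intros k Hk. rewrite !coef_block, Nat.eqb_refl by exact Hk.
      rewrite (Nat.eqb_sym i i'). destruct (Nat.eqb i' i); ring.
  - intros i'' _ Hne. rewrite (sumn_ext p _ (fun _ => 0)); [rewrite sumn_const; ring |].
    intros k Hk. rewrite coef_block by exact Hk.
    destruct (Nat.eqb_spec i'' i); [lia | ring].
Qed.

Lemma sample_mom2 i i' j j' : (i < n)%nat -> (i' < n)%nat -> (j < p)%nat -> (j' < p)%nat ->
  has_gexp (n * p) (fun z => sample p A z i j * sample p A z i' j')
    (m0 ^ (n * p) * (if Nat.eqb i i' then Sigma j j' else 0)).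
Proof.
  intros Hi Hi' Hj Hj'.
  apply (has_gexp_ext _ (prod4 (n * p) 1 zero_vec 1 zero_vec 0 (coef p A i j) 0 (coef p A i' j'))).
  { intro z. unfold prod4. rewrite !aff_const, !sample_aff by assumption. ring. }
  replace (if Nat.eqb i i' then Sigma j j' else 0)
    with (wick 1 1 0 0 (ip (n * p) zero_vec zero_vec) (ip (n * p) zero_vec (coef p A i j))
            (ip (n * p) zero_vec (coef p A i' j')) (ip (n * p) zero_vec (coef p A i j))
            (ip (n * p) zero_vec (coef p A i' j')) (ip (n * p) (coef p A i j) (coef p A i' j'))).
  - apply wick_formula.
  - rewrite !ip_zero_l, ip_coef by assumption. unfold wick. ring.
Qed.

Lemma sample_mom4 i i' j k l m : (i < n)%nat -> (i' < n)%nat ->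
  (j < p)%nat -> (k < p)%nat -> (l < p)%nat -> (m < p)%nat ->
  has_gexp (n * p)
    (fun z => sample p A z i j * sample p A z i k * (sample p A z i' l * sample p A z i' m))
    (m0 ^ (n * p) * (Sigma j k * Sigma l m
       + if Nat.eqb i i' then Sigma j l * Sigma k m + Sigma j m * Sigma k l else 0)).
Proof.
  intros Hi Hi' Hj Hk Hl Hm.
  apply (has_gexp_ext _ (prod4 (n * p) 0 (coef p A i j) 0 (coef p A i k)
                                        0 (coef p A i' l) 0 (coef p A i' m))).
  { intro z. unfold prod4. rewrite !sample_aff by assumption. ring. }
  replace (Sigma j k * Sigma l m
           + if Nat.eqb i i' then Sigma j l * Sigma k m + Sigma j m * Sigma k l else 0)
    with (wick 0 0 0 0 (ip (n * p) (coef p A i j) (coef p A i k))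
            (ip (n * p) (coef p A i j) (coef p A i' l)) (ip (n * p) (coef p A i j) (coef p A i' m))
            (ip (n * p) (coef p A i k) (coef p A i' l)) (ip (n * p) (coef p A i k) (coef p A i' m))
            (ip (n * p) (coef p A i' l) (coef p A i' m))).
  - apply wick_formula.
  - rewrite !ip_coef, !Nat.eqb_refl by assumption. unfold wick. destruct (Nat.eqb i i'); ring.
Qed.

Lemma Shat_mean j k : (j < p)%nat -> (k < p)%nat ->
  has_gexp (n * p) (fun z => Shat p n A z j k) (m0 ^ (n * p) * Sigma j k).
Proof.
  intros Hj Hk. pose proof (INR_pos n hn).
  replace (m0 ^ (n * p) * Sigma j k)
    with (/ INR n * sumn n (fun _ => m0 ^ (n * p) * Sigma j k))
    by (rewrite sumn_const; field; lra).
  apply has_gexp_scal, has_gexp_sumn. intros i Hi.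
  pose proof (sample_mom2 i i j k Hi Hi Hj Hk) as Hm2. now rewrite Nat.eqb_refl in Hm2.
Qed.

Lemma Shat_mom2 j k l m : (j < p)%nat -> (k < p)%nat -> (l < p)%nat -> (m < p)%nat ->
  has_gexp (n * p) (fun z => Shat p n A z j k * Shat p n A z l m)
    (m0 ^ (n * p) * (Sigma j k * Sigma l m
                     + / INR n * (Sigma j l * Sigma k m + Sigma j m * Sigma k l))).
Proof.
  intros Hj Hk Hl Hm. pose proof (INR_pos n hn).
  set (c := Sigma j k * Sigma l m). set (d := Sigma j l * Sigma k m + Sigma j m * Sigma k l).
  apply (has_gexp_ext _ (fun z => / INR n * / INR n * sumn n (fun i => sumn n (fun i' =>
            sample p A z i j * sample p A z i k * (sample p A z i' l * sample p A z i' m))))).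
  { intro z. unfold Shat. rewrite <- sumn_mul. ring. }
  replace (m0 ^ (n * p) * (c + / INR n * d)) with
    (/ INR n * / INR n * sumn n (fun i => sumn n (fun i' =>
       m0 ^ (n * p) * (c + if Nat.eqb i i' then d else 0)))).
  - apply has_gexp_scal. apply has_gexp_sumn; intros i Hi. apply has_gexp_sumn; intros i' Hi'.
    now apply sample_mom4.
  - rewrite (sumn_ext n _ (fun _ => m0 ^ (n * p) * (INR n * c + d))).
    + rewrite sumn_const. field. lra.
    + intros i Hi. rewrite sumn_scal, sumn_plus, sumn_const, sumn_delta by exact Hi. reflexivity.
Qed.

Lemma Sigma_sym : symmetric p Sigma.
Proof. intros j k Hj Hk. rewrite !hA by assumption. apply sumn_ext. intros. ring. Qed.

Lemma frob2_Sigma : frob2 p Sigma = trace_mul p Sigma Sigma.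
Proof.
  apply sumn_ext; intros j Hj; apply sumn_ext; intros k Hk.
  rewrite (Sigma_sym j k) by assumption. ring.
Qed.

Let N := (n * p)%nat.
Let K := m0 ^ N.
Let t1 := trace p Sigma.
Let t2 := trace_mul p Sigma Sigma.

Lemma expected_trace : has_gexp N (fun z => trace p (Shat p n A z)) (K * t1).
Proof.
  unfold t1, trace. rewrite <- sumn_scal.
  apply has_gexp_sumn; intros j Hj. now apply Shat_mean.
Qed.

Lemma expected_trace_mul : has_gexp N (fun z => trace_mul p Sigma (Shat p n A z)) (K * t2).
Proof.
  unfold t2, trace_mul. fold (dsum p (fun j k => Sigma j k * Sigma k j)). rewrite <- dsum_scal.
  apply (has_gexp_dsum p N (fun j k z => Sigma j k * Shat p n A z k j)); intros j k Hj Hk.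
  replace (K * (Sigma j k * Sigma k j)) with (Sigma j k * (K * Sigma k j)) by ring.
  now apply has_gexp_scal, Shat_mean.
Qed.

Lemma expected_frob2 : has_gexp N (fun z => frob2 p (Shat p n A z))
  (K * (t2 + / INR n * (t1 ^ 2 + t2))).
Proof.
  apply (has_gexp_ext N (fun z => dsum p (fun j k => Shat p n A z j k * Shat p n A z j k)));
    [intro; apply dsum_ext; intros; ring |].
  replace (K * (t2 + / INR n * (t1 ^ 2 + t2))) with (dsum p (fun j k =>
    K * (Sigma j k * Sigma j k + / INR n * (Sigma j j * Sigma k k + Sigma j k * Sigma k j)))).
  - apply has_gexp_dsum; intros j k Hj Hk. now apply Shat_mom2.
  - unfold t1, t2. rewrite <- frob2_Sigma at 1. unfold trace_mul, frob2.
    rewrite trace_sq. fold (dsum p (fun j k => Sigma j k * Sigma k j)).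
    fold (dsum p (fun j k => Sigma j k ^ 2)).
    rewrite (dsum_ext p _ (fun j k => K * Sigma j k ^ 2 + (K * / INR n) * (Sigma j j * Sigma k k)
                                      + (K * / INR n) * (Sigma j k * Sigma k j))) by (intros; ring).
    rewrite !dsum_plus, !dsum_scal. ring.
Qed.

Lemma expected_trace_sq : has_gexp N (fun z => trace p (Shat p n A z) ^ 2)
  (K * (t1 ^ 2 + / INR n * (2 * t2))).
Proof.
  apply (has_gexp_ext N (fun z => dsum p (fun j k => Shat p n A z j j * Shat p n A z k k)));
    [intro; symmetry; apply trace_sq |].
  replace (K * (t1 ^ 2 + / INR n * (2 * t2))) with (dsum p (fun j k =>
    K * (Sigma j j * Sigma k k + / INR n * (Sigma j k * Sigma j k + Sigma j k * Sigma j k)))).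
  - apply has_gexp_dsum; intros j k Hj Hk. now apply Shat_mom2.
  - unfold t1, t2. rewrite <- frob2_Sigma, trace_sq. unfold frob2.
    fold (dsum p (fun j k => Sigma j k ^ 2)).
    rewrite (dsum_ext p _ (fun j k => K * (Sigma j j * Sigma k k) + (2 * K * / INR n) * Sigma j k ^ 2))
      by (intros; ring).
    rewrite !dsum_plus, !dsum_scal. ring.
Qed.

Lemma expected_numerator :
  has_gexp N (fun z => trace_mul p (fun j k => Sigma j k - Shat p n A z j k)
                                   (fun j k => Fhat p n A z j k - Shat p n A z j k))
    (K * oracle_num p n t1 t2).
Proof.
  pose proof (INR_pos p hp). pose proof (INR_pos n hn).
  apply (has_gexp_ext N (fun z => t1 / INR p * trace p (Shat p n A z)
           + (-1) * trace_mul p Sigma (Shat p n A z)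
           + (- / INR p) * trace p (Shat p n A z) ^ 2 + 1 * frob2 p (Shat p n A z))).
  { intro z. unfold Fhat. rewrite trace_mul_shrink by auto using Shat_sym. fold t1. field. lra. }
  replace (K * oracle_num p n t1 t2) with (t1 / INR p * (K * t1) + (-1) * (K * t2)
    + (- / INR p) * (K * (t1 ^ 2 + / INR n * (2 * t2))) + 1 * (K * (t2 + / INR n * (t1 ^ 2 + t2))))
    by (unfold oracle_num; field; lra).
  repeat apply has_gexp_lin; [apply has_gexp_scal | ..].
  - exact expected_trace.
  - exact expected_trace_mul.
  - exact expected_trace_sq.
  - exact expected_frob2.
Qed.

Lemma expected_denominator :
  has_gexp N (fun z => frob2 p (fun j k => Shat p n A z j k - Fhat p n A z j k))
    (K * oracle_den p n t1 t2).
Proof.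
  pose proof (INR_pos p hp). pose proof (INR_pos n hn).
  apply (has_gexp_ext N (fun z => frob2 p (Shat p n A z) + (- / INR p) * trace p (Shat p n A z) ^ 2)).
  { intro z. unfold Fhat. rewrite frob2_minus_target by exact hp. field. lra. }
  replace (K * oracle_den p n t1 t2) with (K * (t2 + / INR n * (t1 ^ 2 + t2))
    + (- / INR p) * (K * (t1 ^ 2 + / INR n * (2 * t2))))
    by (unfold oracle_den; field; lra).
  apply has_gexp_lin.
  - exact expected_frob2.
  - exact expected_trace_sq.
Qed.

Lemma expected_fit :
  has_gexp N (fun z => frob2 p (fun j k => Shat p n A z j k - Sigma j k))
    (K * (/ INR n * (t1 ^ 2 + t2))).
Proof.
  apply (has_gexp_ext N (fun z => frob2 p (Shat p n A z) + (-2) * trace_mul p Sigma (Shat p n A z)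
                                  + 1 * t2)).
  { intro z. rewrite frob2_minus by apply Shat_sym. rewrite frob2_Sigma. fold t2.
    ring. }
  replace (K * (/ INR n * (t1 ^ 2 + t2))) with (K * (t2 + / INR n * (t1 ^ 2 + t2))
    + (-2) * (K * t2) + 1 * (K * t2)) by ring.
  repeat apply has_gexp_lin.
  - exact expected_frob2.
  - exact expected_trace_mul.
  - apply has_gexp_const.
Qed.

Lemma risk_quadratic r :
  has_gexp N
    (fun z => frob2 p (fun j k => (1 - r) * Shat p n A z j k + r * Fhat p n A z j k - Sigma j k))
    (K * (/ INR n * (t1 ^ 2 + t2)) + (-2 * r) * (K * oracle_num p n t1 t2)
     + r ^ 2 * (K * oracle_den p n t1 t2)).
Proof.
  apply (has_gexp_ext _ (fun z => frob2 p (fun j k => Shat p n A z j k - Sigma j k)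
     + (-2 * r) * trace_mul p (fun j k => Sigma j k - Shat p n A z j k)
                              (fun j k => Fhat p n A z j k - Shat p n A z j k)
     + r ^ 2 * frob2 p (fun j k => Shat p n A z j k - Fhat p n A z j k))).
  { intro z. rewrite shrinkage_loss by (apply Shat_sym || apply idmat_symmetric). ring. }
  repeat apply has_gexp_lin;
    [apply expected_fit | apply expected_numerator | apply expected_denominator].
Qed.

End Moments.

Lemma quadratic_strict_min a b c x : 0 < c -> x <> b / c ->
  a + (-2 * (b / c)) * b + (b / c) ^ 2 * c < a + (-2 * x) * b + x ^ 2 * c.
Proof.
  intros Hc Hx.
  assert (0 < (x - b / c) ^ 2).
  { replace ((x - b / c) ^ 2) with (Rsqr (x - b / c)) by (unfold Rsqr; ring).
    apply Rsqr_pos_lt. lra. }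
  replace (a + (-2 * x) * b + x ^ 2 * c)
    with (a + (-2 * (b / c)) * b + (b / c) ^ 2 * c + c * (x - b / c) ^ 2) by (field; lra).
  pose proof (Rmult_lt_0_compat c _ Hc H). lra.
Qed.

Lemma diag_pos p (Sigma : mat) j :
  (forall v : nat -> R, (exists j, (j < p)%nat /\ v j <> 0) ->
     0 < sumn p (fun j => sumn p (fun k => v j * Sigma j k * v k))) ->
  (j < p)%nat -> 0 < Sigma j j.
Proof.
  intros hpd Hj. set (e := fun l => if Nat.eqb l j then 1 else 0).
  assert (He : forall l, l <> j -> e l = 0)
    by (intros l Hl; unfold e; now rewrite (proj2 (Nat.eqb_neq l j) Hl)).
  assert (Hej : e j = 1) by (unfold e; now rewrite Nat.eqb_refl).
  assert (Hex : exists j0, (j0 < p)%nat /\ e j0 <> 0) by (exists j; split; [exact Hj | lra]).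
  specialize (hpd e Hex).
  rewrite (sumn_single p j), (sumn_single p j) in hpd; auto.
  - rewrite Hej in hpd. lra.
  - intros k _ Hk. rewrite (He k Hk). ring.
  - intros l _ Hl. rewrite (sumn_ext p _ (fun _ => 0)); [rewrite sumn_const; ring |].
    intros k _. rewrite (He l Hl). ring.
Qed.

Lemma trace_pos p (Sigma : mat) : (0 < p)%nat ->
  (forall v : nat -> R, (exists j, (j < p)%nat /\ v j <> 0) ->
     0 < sumn p (fun j => sumn p (fun k => v j * Sigma j k * v k))) ->
  0 < trace p Sigma.
Proof.
  intros Hp hpd. apply Rlt_le_trans with (Sigma 0%nat 0%nat); [now apply (diag_pos p) |].
  apply (sumn_ge_term p (fun j => Sigma j j)); [| exact Hp].
  intros j Hj. left. now apply (diag_pos p).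
Qed.

Lemma oracle_den_pos p n t1 t2 : (2 <= p)%nat -> (1 <= n)%nat -> 0 < t1 -> t1 ^ 2 <= INR p * t2 ->
  0 < oracle_den p n t1 t2.
Proof.
  intros hp hn Ht1 Hcs.
  assert (Pp : 2 <= INR p) by (apply (le_INR 2 p) in hp; simpl in hp; lra).
  assert (Pn : 1 <= INR n) by (apply (le_INR 1 n) in hn; simpl in hn; lra).
  unfold oracle_den. apply Rdiv_lt_0_compat; [| lra].
  replace ((INR n + 1 - 2 / INR p) * t2 + (1 - INR n / INR p) * t1 ^ 2) with
    (INR n / INR p * (INR p * t2 - t1 ^ 2) + (1 - 2 / INR p) * t2 + t1 ^ 2) by (field; lra).
  assert (0 <= INR n / INR p)
    by (unfold Rdiv; apply Rmult_le_pos; [lra | left; apply Rinv_0_lt_compat; lra]).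
  assert (0 <= 1 - 2 / INR p).
  { assert (2 / INR p <= 1); [apply (Rmult_le_reg_r (INR p)); [lra |] |lra].
    replace (2 / INR p * INR p) with 2 by (field; lra). lra. }
  assert (0 < t1 ^ 2) by (apply pow_lt; lra).
  assert (0 <= t2) by nra.
  assert (0 <= INR n / INR p * (INR p * t2 - t1 ^ 2)) by (apply Rmult_le_pos; lra).
  assert (0 <= (1 - 2 / INR p) * t2) by (apply Rmult_le_pos; lra).
  lra.
Qed.

Lemma oracle_ratio p n t1 t2 K : (0 < p)%nat -> (1 <= n)%nat -> K <> 0 ->
  0 < oracle_den p n t1 t2 ->
  K * oracle_num p n t1 t2 / (K * oracle_den p n t1 t2) =
  ((1 - 2 / INR p) * t2 + t1 ^ 2) / ((INR n + 1 - 2 / INR p) * t2 + (1 - INR n / INR p) * t1 ^ 2).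
Proof.
  intros hp hn HK Hden.
  pose proof (INR_pos p hp). pose proof (INR_pos n hn).
  unfold oracle_den, oracle_num in *.
  set (Y := (INR n + 1 - 2 / INR p) * t2 + (1 - INR n / INR p) * t1 ^ 2) in *.
  assert (HY : 0 < Y).
  { replace Y with (Y / INR n * INR n) by (field; lra). apply Rmult_lt_0_compat; lra. }
  field. repeat split; [lra | lra | lra | exact HK].
Qed.

Theorem theorem1 (p n : nat) (Sigma A : mat)
  (hp : (2 <= p)%nat) (hn : (1 <= n)%nat)
  (hsym : forall j k, (j < p)%nat -> (k < p)%nat -> Sigma j k = Sigma k j)
  (hpd : forall v : nat -> R, (exists j, (j < p)%nat /\ v j <> 0) ->
           0 < sumn p (fun j => sumn p (fun k => v j * Sigma j k * v k)))
  (hA : forall j k, (j < p)%nat -> (k < p)%nat ->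
           Sigma j k = sumn p (fun l => A j l * A k l)) :
  let E := gexp (n * p) in
  let risk := fun rho : R =>
    E (fun z => frob2 p (fun j k =>
         (1 - rho) * Shat p n A z j k + rho * Fhat p n A z j k - Sigma j k)) in
  exists rhoO : R,
    (forall rho, rho <> rhoO -> risk rhoO < risk rho) /\
    rhoO = E (fun z => trace_mul p (fun j k => Sigma j k - Shat p n A z j k)
                                   (fun j k => Fhat p n A z j k - Shat p n A z j k))
           / E (fun z => frob2 p (fun j k => Shat p n A z j k - Fhat p n A z j k)) /\
    rhoO = ((1 - 2 / INR p) * trace_mul p Sigma Sigma + (trace p Sigma) ^ 2)
           / ((INR n + 1 - 2 / INR p) * trace_mul p Sigma Sigma
              + (1 - INR n / INR p) * (trace p Sigma) ^ 2).
Proof.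
  intros E risk. subst E risk. cbv beta.
  assert (hp0 : (0 < p)%nat) by lia.
  set (t1 := trace p Sigma). set (t2 := trace_mul p Sigma Sigma). set (K := m0 ^ (n * p)).
  assert (HK : 0 < K) by (apply pow_lt, m0_spec).
  assert (Hden : 0 < K * oracle_den p n t1 t2).
  { apply Rmult_lt_0_compat; [exact HK |]. apply oracle_den_pos; auto.
    - now apply trace_pos.
    - unfold t2. rewrite <- (frob2_Sigma p Sigma A hA). apply trace_sq_le. }
  rewrite (proj2 (expected_numerator p n Sigma A hp0 hn hA)),
          (proj2 (expected_denominator p n Sigma A hp0 hn hA)).
  exists (K * oracle_num p n t1 t2 / (K * oracle_den p n t1 t2)). split; [| split].
  - intros rho Hrho. rewrite !(proj2 (risk_quadratic p n Sigma A hp0 hn hA _)).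
    now apply quadratic_strict_min.
  - reflexivity.
  - apply oracle_ratio; auto. apply Rgt_not_eq, HK.
    apply (Rmult_lt_reg_l K); lra.
Qed.
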